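(* For every integer $k\geq 2$, every forest $G$ is a $k$-König–Egerváry graph, i.e. $\alpha_k(G)+\mu_k(G)=|V(G)|$.
   Context: All graphs are finite, simple and undirected. A $k$-path is a (not necessarily induced) subgraph isomorphic to the path on $k$ vertices. A $k$-matching of $G$ is a set of pairwise vertex-disjoint $k$-paths in $G$, and $\mu_k(G)$ is the maximum cardinality (number of paths) of a $k$-matching. A $k$-independent set is a set $S$ of vertices such that the induced subgraph $G[S]$ contains no $k$-path, and $\alpha_k(G)$ is the maximum cardinality of a $k$-independent set. A graph $G$ is called $k$-König–Egerváry if $\alpha_k(G)+\mu_k(G)=|V(G)|$. *)

(* Defs.v *)
From mathcomp Require Import all_boot.

Set Implicit Arguments.
Unset Strict Implicit.
Unset Printing Implicit Defensive.

(* A finite simple graph is a symmetric irreflexive relation e on a finType.  *)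
(* Its subgraphs are explicit pairs (vertex set, edge set), an edge being the *)
(* set of its two ends.                                                       *)
Definition subgr (T : finType) : Type := ({set T} * {set {set T}})%type.

Section Defs.
Variable T : finType.
Implicit Types (e : rel T) (S : {set T}) (G H : subgr T) (M : {set subgr T}).

Definition induced e S : subgr T :=
  (S, [set [set x; y] | x in S, y in S & e x y]).

Definition whole e : subgr T := induced e [set: T].

(* The last conjunct says that H is itself a graph. *)
Definition subgraph H G : bool :=
  [&& H.1 \subset G.1, H.2 \subset G.2 & [forall A in H.2, A \subset H.1]].

(* f is an isomorphism onto H from the graph on 'I_k in which i and j are     *)
(* adjacent when they are consecutive.                                        *)
Definition path_graph (k : nat) H : bool :=
  [exists f : {ffun 'I_k -> T},
    [&& injectiveb f, H.1 == [set f i | i : 'I_k]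
      & [forall i : 'I_k, forall j : 'I_k,
          ([set f i; f j] \in H.2) == ((i.+1 == j :> nat) || (j.+1 == i :> nat))]]].

Definition kpath k G H : bool := subgraph H G && path_graph k H.

Definition kmatching k e M : bool :=
  [forall H in M, kpath k (whole e) H] &&
  [forall H1 in M, forall H2 in M, (H1 != H2) ==> [disjoint H1.1 & H2.1]].

Definition mu k e : nat := \max_(M : {set subgr T} | kmatching k e M) #|M|.

Definition kindependent k e S : bool :=
  ~~ [exists H : subgr T, kpath k (induced e S) H].

Definition alpha k e : nat := \max_(S : {set T} | kindependent k e S) #|S|.

Definition konig_egervary k e : Prop := alpha k e + mu k e = #|T|.

(* The bound on the size is needed because ucycle e [:: x; y] holds for every *)
(* edge xy.                                                                   *)
Definition forest e : Prop := forall c : seq T, 2 < size c -> ~ ucycle e c.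

End Defs.

(* Main.v *)
(* Among the pairs (v, B) such that B contains a k-path and v is the only      *)
(* vertex of B with neighbours outside B, take one with B minimal. In a        *)
(* forest v has at most one neighbour in each component of B - v, so a         *)
(* component containing a k-path would give a smaller pair; hence v meets all  *)
(* the k-paths in B. Deleting B removes one path of the matching and one       *)
(* vertex of the transversal, and every k-path avoiding v and leaving B lies   *)
(* outside B, so induction builds a matching and a transversal of equal size.  *)
Require Import Defs.
From mathcomp Require Import all_boot.

Set Implicit Arguments.
Unset Strict Implicit.
Unset Printing Implicit Defensive.

Section KPaths.
Variables (T : finType) (e : rel T) (k : nat).
Hypotheses (k_gt0 : 0 < k) (e_sym : symmetric e).
Implicit Types (A B S X : {set T}) (H : subgr T) (M : {set subgr T}).

(** The complement of a k-independent set is a set meeting every k-path, so the claim is a min-max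
    equality between transversals and packings of k-paths. One inequality,
    [card_kindependent_kmatching], holds in every graph. For the other, [forest_transversal] builds
    a transversal no larger than a matching, cutting off the sets supplied by
    [pendant_kindependent]; acyclicity enters through [forest_neighbor_uniq]. *)

Definition adj A : rel T := [rel x y | [&& e x y, x \in A & y \in A]].

Lemma adj_connect_sym A : connect_sym (adj A).
Proof.
by apply: sym_connect_sym => x y; rewrite /adj /= e_sym (andbC (x \in A)).
Qed.

Lemma kpath_vertices A H : kpath k (induced e A) H -> H.1 \subset A.
Proof. by case/andP=> /and3P[]. Qed.

Lemma kpath_neq0 A H : kpath k (induced e A) H -> exists x, x \in H.1.
Proof.
case/andP=> _ /existsP[f /and3P[_ /eqP-> _]].
by exists (f (Ordinal k_gt0)); apply: imset_f.
Qed.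

(** Edges of [H] have both ends in [H.1], so only the vertex set decides which induced subgraphs
    contain [H]. *)
Lemma kpath_induced A B H :
  kpath k (induced e A) H -> H.1 \subset B -> kpath k (induced e B) H.
Proof.
case/andP=> /and3P[_ sEA /forallP /= sEV] pH sHB.
rewrite /kpath pH andbT; apply/and3P; split=> //=; last exact/forallP.
apply/subsetP=> E EH; have /imset2P[x y] := subsetP sEA E EH.
rewrite inE => _ /andP[_ exy] defE.
have /subsetP sE : E \subset B.
  by apply: subset_trans sHB; have := sEV E; rewrite EH.
apply/imset2P; exists x y => //; first by rewrite sE // defE !inE eqxx.
by rewrite inE exy sE // defE !inE eqxx orbT.
Qed.

Lemma kpath_connect A H x y :
  kpath k (induced e A) H -> x \in H.1 -> y \in H.1 -> connect (adj A) x y.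
Proof.
case/andP=> /and3P[_ sEA _] /existsP[f].
case/and3P=> /injectiveP f_inj /eqP-> /forallP edgeP.
have adjS (i j : 'I_k) : i.+1 = j :> nat -> adj A (f i) (f j).
  move=> ij; have /forallP/(_ j)/eqP := edgeP i; rewrite ij eqxx /=.
  move=> /(subsetP sEA) /imset2P[a b]; rewrite inE => aA /andP[bA eab] defE.
  have fij : f i != f j.
    by rewrite (inj_eq f_inj) -val_eqE /= -ij neq_ltn ltnSn.
  have: f i \in [set a; b] by rewrite -defE !inE eqxx.
  have: f j \in [set a; b] by rewrite -defE !inE eqxx orbT.
  rewrite !inE; move: fij => /[swap] /pred2P[] -> /[swap] /pred2P[] ->.
  - by rewrite eqxx.
  - by rewrite /adj /= e_sym eab bA.
  - by rewrite /adj /= eab aA.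
  by rewrite eqxx.
have conn0 n (n_lt : n < k) : connect (adj A) (f (Ordinal k_gt0)) (f (Ordinal n_lt)).
  elim: n n_lt => [|n IHn] n_lt.
    by rewrite (_ : Ordinal n_lt = Ordinal k_gt0) ?connect0 //; apply: val_inj.
  by apply: connect_trans (IHn (ltnW n_lt)) (connect1 _); apply: adjS.
move=> /imsetP[[i i_lt] _ ->] /imsetP[[j j_lt] _ ->].
by apply: connect_trans (conn0 j j_lt); rewrite adj_connect_sym.
Qed.

(** Each path of [M] has a vertex outside [S], and disjointness makes the choice of such vertices
    injective. *)
Lemma card_kindependent_kmatching S M :
  kindependent k e S -> kmatching k e M -> #|S| + #|M| <= #|T|.
Proof.
move=> indS /andP[/forallP Mk /forallP Mdis].
rewrite -(cardsC S) leq_add2l.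
pose g H := [pick x in H.1 :\: S].
have gP H : H \in M -> exists2 x, g H = Some x & x \in H.1 :\: S.
  move=> HM; rewrite /g; case: pickP => [x xH|no]; first by exists x.
  case/negP: indS; apply/existsP; exists H.
  apply: (kpath_induced (implyP (Mk H) HM)).
  by rewrite -setD_eq0; apply/eqP/setP=> x; rewrite in_set0; apply: no.
have g_inj : {in M &, injective g}.
  move=> H1 H2 H1M H2M eq_g; apply/eqP/contraT => neqH.
  have [x gx] := gP _ H1M; have [y] := gP _ H2M.
  rewrite -eq_g gx => -[<-] /setDP[x2 _] /setDP[x1 _].
  have /forallP/(_ H2) := implyP (Mdis H1) H1M; rewrite H2M neqH /=.
  by move/pred0P/(_ x); rewrite /= x1 x2.
rewrite -(card_in_imset g_inj) -(card_imset (mem (~: S)) Some_inj).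
apply: subset_leq_card; apply/subsetP=> _ /imsetP[H HM ->].
have [x -> /setDP[_ xS]] := gP H HM.
by apply: imset_f; rewrite inE.
Qed.

Hypothesis e_forest : forest e.

(** Otherwise a simple path in [A] from [x] to [y], closed up through [v], would be a cycle on at
    least three vertices. *)
Lemma forest_neighbor_uniq A v x y :
  v \notin A -> x \in A -> e v x -> e v y -> connect (adj A) x y -> x = y.
Proof.
move=> vA xA vx vy /connectP[p0 /shortenP[p xp Up _] y_last].
case: p xp Up y_last => [|z p] xp Up y_last; first by rewrite y_last.
case: (e_forest (c := [:: v, x, z & p])) => //.
have sub : subrel (adj A) e by move=> a b /and3P[].
have path_all s b : path (adj A) b s -> all [in A] s.
  by elim: s b => //= a s IHs b /andP[/and3P[_ _ ->]] /IHs.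
apply/andP; split.
  rewrite (cycle_path v) /= -/(path e x (z :: p)).
  have /= -> := sub_path sub xp.
  by rewrite vx -[last z p]/(last x (z :: p)) -y_last e_sym vy.
rewrite cons_uniq Up andbT; apply: contra vA => /predU1P[-> //|].
by move/allP: (path_all _ _ xp); apply.
Qed.

(** For [v] in [B] and [B] inside [A], this says that [B :\ v] is a union of components of the graph
    induced on [A :\ v]. *)
Definition pendant A v B :=
  [forall x in B :\ v, forall y in A, e x y ==> (y \in B)].

Lemma pendantP A v B :
  reflect (forall x y, x \in B -> x != v -> y \in A -> e x y -> y \in B)
          (pendant A v B).
Proof.
apply: (iffP forallP) => [pvB x y xB xv yA exy | pvB x].
  have /forallP/(_ y) : [forall y in A, e x y ==> (y \in B)].
    by have := pvB x; rewrite !inE xB xv; apply.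
  by rewrite yA exy.
apply/implyP; rewrite !inE => /andP[xv xB].
by apply/forall_inP=> y yA; apply/implyP; apply: pvB.
Qed.

Lemma pendant_kindependent A :
  ~~ kindependent k e A -> exists v B,
  [/\ v \in B, B \subset A, pendant A v B, ~~ kindependent k e B
    & kindependent k e (B :\ v)].
Proof.
move=> pathA; have /existsP[H0 H0A] := negbNE pathA.
have [v0 v0H] := kpath_neq0 H0A.
pose P (u : T * {set T}) :=
  [&& u.1 \in u.2, u.2 \subset A, pendant A u.1 u.2 & ~~ kindependent k e u.2].
have P0 : P (v0, A).
  rewrite /P /= subxx pathA (subsetP (kpath_vertices H0A)) //= andbT.
  by apply/pendantP.
have [[v B] /and4P[/= vB sBA /pendantP pvB pathB] minB] :=
  arg_minnP (fun u : T * {set T} => #|u.2|) P0.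
exists v, B; split=> //; first exact/pendantP.
apply/negbNE/negP => /negbNE/existsP[H HBv].
have [w0 w0H] := kpath_neq0 HBv.
have w0Bv := subsetP (kpath_vertices HBv) _ w0H.
(* The component of [B :\ v] containing [H]; with a suitable [w] it will contradict the minimality
   of [B]. *)
pose C := [set y | connect (adj (B :\ v)) w0 y].
have w0C : w0 \in C by rewrite inE connect0.
have sCBv : C \subset B :\ v.
  apply/subsetP=> y; rewrite inE => w0y.
  have clB : closed (adj (B :\ v)) (mem (B :\ v)).
    by move=> a b /and3P[_ aB bB]; rewrite [LHS]aB [RHS]bB.
  by rewrite -(closed_connect clB w0y).
have pathC : ~~ kindependent k e C.
  apply/negPn/existsP; exists H; apply: (kpath_induced HBv).
  by apply/subsetP=> y yH; rewrite inE; apply: kpath_connect HBv _ _.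
(* If [v] has no neighbour in [C], any vertex of [C] serves as [w]. *)
have [w wC w_nbr] : exists2 w, w \in C & forall x, x \in C -> e v x -> x = w.
  case: (pickP [pred x in C | e v x]) => [w /andP[wC vw]|noC].
    exists w => // x xC vx.
    apply: (@forest_neighbor_uniq (B :\ v)) vx vw _.
    - by rewrite !inE eqxx.
    - exact: subsetP sCBv x xC.
    move: xC wC; rewrite !inE => xC; apply: connect_trans.
    by rewrite adj_connect_sym.
  by exists w0 => // x xC vx; have := noC x; rewrite /= xC vx.
have ltCB : #|C| < #|B|.
  by rewrite (cardsD1 v B) vB ltnS subset_leq_card.
have := minB (w, C); rewrite leqNgt ltCB => /(_ _)/negP[] //.
apply/and4P; split=> //=.
  by apply: subset_trans sCBv (subset_trans (subsetDl _ _) sBA).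
apply/pendantP=> x y xC xw yA exy.
have := subsetP sCBv x xC; rewrite !inE => /andP[xv xB].
have yB := pvB x y xB xv yA exy.
have yv : y != v.
  by apply: contraNneq xw => yv; rewrite (w_nbr x) // -yv e_sym.
rewrite inE in xC.
by apply: connect_trans xC (connect1 _); rewrite /adj /= exy !inE xv xB yv yB.
Qed.

Lemma forest_transversal A : exists X M,
  [/\ #|X| <= #|M|, kindependent k e (A :\: X),
      forall H, H \in M -> kpath k (induced e A) H
    & {in M &, forall H1 H2, H1 != H2 -> [disjoint H1.1 & H2.1]}].
Proof.
have [n] := ubnP #|A|; elim: n A => // n IHn A; rewrite ltnS => leAn.
have [indA|pathA] := boolP (kindependent k e A).
  exists set0, set0; rewrite !cards0 setD0.
  by split=> // [H|H1 H2]; rewrite inE.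
have [v [B [vB sBA /pendantP pvB pathB indBv]]] := pendant_kindependent pathA.
have /existsP[H0 H0B] := negbNE pathB.
have [x0 x0H0] := kpath_neq0 H0B.
have sH0B := kpath_vertices H0B.
have [|X [M [leXM indX Mk Mdis]]] := IHn (A :\: B).
  apply: leq_trans leAn; apply/proper_card/properP; split; first exact: subsetDl.
  by exists v; [apply: (subsetP sBA) | rewrite !inE vB].
have disH0 H : H \in M -> [disjoint H0.1 & H.1].
  move=> /Mk /kpath_vertices; rewrite subsetD => /andP[_].
  by rewrite disjoint_sym; apply: disjointWl.
exists (v |: X), (H0 |: M); split.
- have H0M : H0 \notin M.
    apply/negP=> /disH0 /pred0P/(_ x0) /=.
    by rewrite x0H0.
  by rewrite (cardsU1 H0) H0M cardsU1; apply: leq_add; rewrite ?leq_b1.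
- apply/negP=> /existsP[H HA].
  have /subsetP sHA := kpath_vertices HA.
  have [x1 x1H] := kpath_neq0 HA.
  (* Once [v] is removed no edge leaves [B], so [H] lies wholly inside [B], against [indBv], or
     wholly outside, against [indX]. *)
  have clB : closed (adj (A :\: (v |: X))) (mem B).
    apply: (intro_closed (adj_connect_sym _)) => x y /and3P[exy].
    rewrite !inE !negb_or -!andbA => /and3P[xv _ _] /and3P[_ _ yA] xB.
    exact: pvB exy.
  have eqB y : y \in H.1 -> (y \in B) = (x1 \in B).
    move=> yH; apply/esym/(closed_connect clB).
    exact: kpath_connect HA _ _.
  case x1B: (x1 \in B).
    case/negP: indBv; apply/existsP; exists H; apply: (kpath_induced HA).
    apply/subsetP=> y yH; have := sHA y yH; rewrite !inE eqB // x1B.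
    by case: eqP.
  case/negP: indX; apply/existsP; exists H; apply: (kpath_induced HA).
  apply/subsetP=> y yH; have := sHA y yH; rewrite !inE eqB // x1B negb_or.
  by case/andP=> /andP[_ ->].
- move=> H /setU1P[->|/Mk HAB].
    exact: kpath_induced H0B (subset_trans sH0B sBA).
  apply: (kpath_induced HAB).
  exact: subset_trans (kpath_vertices HAB) (subsetDl _ _).
move=> H1 H2 /setU1P[->|H1M] /setU1P[->|H2M]; rewrite ?eqxx // => neqH.
- exact: disH0.
- by rewrite disjoint_sym; apply: disH0.
exact: Mdis.
Qed.

End KPaths.

Theorem theorem2p1 (k : nat) (T : finType) (e : rel T) :
  2 <= k -> symmetric e -> irreflexive e -> forest e -> konig_egervary k e.
Proof.
move=> /ltnW k_gt0 e_sym _ e_forest; rewrite /konig_egervary.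
have [X [M [leXM indX Mk Mdis]]] :=
  forest_transversal k_gt0 e_sym e_forest [set: T].
have matM : kmatching k e M.
  apply/andP; split; first exact/forall_inP.
  apply/forall_inP=> H1 H1M; apply/forall_inP=> H2 H2M; apply/implyP.
  exact: Mdis.
apply/eqP; rewrite eqn_leq; apply/andP; split.
  (* [setT :\: X] and [M] only witness that the two maxima range over nonempty families, hence are
     attained. *)
  rewrite /alpha /mu (bigmax_eq_arg (setT :\: X)) // (bigmax_eq_arg M) //.
  case: arg_maxnP => // S indS _; case: arg_maxnP => // N matN _.
  exact: card_kindependent_kmatching indS matN.
(* The complement of [X] bounds [alpha] from below, and [M], at least as large as [X], bounds
   [mu]. *)
rewrite -(cardsC X) addnC; apply: leq_add.
  by rewrite -setTD; apply: (bigmax_sup (setT :\: X)).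
exact: (bigmax_sup M).
Qed.
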